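(* Let $\alpha_t\in\mathbb{R}^N_+$ ($t\in[T]$) be probes, let $\beta_t^i\in\mathbb{R}^N_+$ ($t\in[T]$, $i\in[M]$) be the true responses, and let $\tilde\beta_t^i=\beta_t^i+\epsilon_t^i$ be the noisy responses, giving the noisy dataset $\tilde{\mathcal D}=\{\alpha_t,\tilde\beta_t^i : t\in[T], i\in[M]\}$. Let $H_0$, $H_1$, $\hat\Phi^i(\tilde{\mathcal D})$, $\Phi^*$, $\Psi^i$, $\Psi$, $\bar F_\Psi$ be as defined in the context, let $\gamma\in(0,1)$, and suppose that the problem defining $\hat\Phi^i(\tilde{\mathcal D})$ has a feasible solution. Then: 1. The following null hypothesis implication holds: $$H_0\subseteq\bigcap_{i\in[M]}\{\hat\Phi^i(\tilde{\mathcal D})\le\Psi^i\}.$$ 2. The probability of Type-I error (false alarm) satisfies $$\mathbb{P}_{\Phi^*}(H_1\mid H_0):=\mathbb{P}\big(\bar F_\Psi(\Phi^* )\le\gamma \,\big|\, H_0\big)\le\gamma .$$ 3. The optimizer $\Phi^*$ yields the smallest Type-I error bound: $$\mathbb{P}_{\bar\Phi(\tilde{\mathcal D})}(H_1\mid H_0)\ \ge\ \mathbb{P}_{\Phi^*}(H_1\mid H_0)\qquad\text{for all } \bar\Phi(\tilde{\mathcal D})\in[\Phi^*,\Psi],$$ where $\mathbb{P}_{\bar\Phi(\tilde{\mathcal D})}(H_1\mid H_0):=\mathbb{P}\big(\bar F_\Psi(\bar\Phi(\tilde{\mathcal D}))\le\gamma\,\big|\,H_0\big)$ is the Type-I error probability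 when the statistic $\bar\Phi(\tilde{\mathcal D})$ is used in place of $\Phi^*$.
   Context: Notation: $[n]=\{1,\dots,n\}$; $M$ is the number of agents, $T$ the number of time points, $N$ the dimension. Noise. The noises $\epsilon_t^i$ are independent $\mathbb{R}^N$-valued random variables, $\epsilon_t^i$ having some distribution $\Lambda_t^i$. Hypotheses. $H_0$ (null hypothesis): the data arise from coordination for all $t\in[T]$, i.e. there are concave, continuous, monotone increasing functions $f^i:\mathbb{R}^N_+\to\mathbb{R}$, $i\in[M]$, and weights $\mu^i>0$ such that for all $t\in[T]$ the true responses satisfy $$\{\beta_t^i\}_{i=1}^M\in\arg\max_{\{\beta^i\}_{i=1}^M}\ \sum_{i=1}^M\mu^i f^i(\beta^i)\quad\text{s.t.}\quad \alpha_t^\top\Big(\sum_{i=1}^M\beta^i\Big)\le 1,\qquad \beta^i\in\mathbb{R}^N_+ .$$ $H_1$ (alternative hypothesis): the data do not arise in this way. Test statistic. For each $i\in[M]$, $\hat\Phi^i(\tilde{\mathcal D})$ is the minimum of all $\Phi^i$ for which there exist $u_t^i>0$, $\lambda_t^i>0$ ($t\in[T]$) with $$u_s^i-u_t^i-\lambda_t^i\alpha_t^\top(\tilde\beta_s^i-\tilde\beta_t^i)-\lambda_t^i\Phi^i\le 0\qquad\text{for all } s,t\in[T].$$ Set $\Phi^*=\max_{i\in[M]}\hat\Phi^i(\tilde{\mathcal D})$. Noise variables. $\Psi^i=\max_{t\ne s}\big[\alpha_t^\top(\epsilon_t^i-\epsilon_s^i)\big]$ and $\Psi=\max_{i\in[M]}\Psi^i$.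 The random variable $\Psi$ has probability density function $f_\Psi$, cdf $F_\Psi$ and complementary cdf $\bar F_\Psi=1-F_\Psi$. Detector. The detector computes $\int_{\Phi^*}^\infty f_\Psi(\psi)\,d\psi=\bar F_\Psi(\Phi^* )$, decides $H_0$ if this is $\ge\gamma$ and $H_1$ if it is $<\gamma$. Type-I error is rejecting $H_0$ when $H_0$ is valid.
   Formalization: The inequalities defining Φ̂^i are imposed only for s≠t: with s=t they force Φ̂^i≥0 while Ψ^i can be negative, so claims 1 and 2 fail as written. The minimum is read as an infimum, and ''increasing'' as strict when all coordinates increase. *)

(* Defs.v *)
From HB Require Import structures.
From mathcomp Require Import all_boot all_order all_algebra.
From mathcomp Require Import all_classical all_reals all_analysis measurable_realfun.

Set Implicit Arguments.
Unset Strict Implicit.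
Unset Printing Implicit Defensive.

Import Order.TTheory GRing.Theory Num.Theory.
Import numFieldNormedType.Exports.

Local Open Scope classical_set_scope.
Local Open Scope ring_scope.

(* Maximum of the real numbers F i over the i with A i. The bottom element -oo
   of \bar R only serves as the initial value: the result is the genuine
   maximum as soon as A is nonempty (fmax_ge and fmax_attained), and the junk
   value 0 if A is empty. *)
Definition fmax (R : realType) (I : finType) (A : pred I) (F : I -> R) : R :=
  fine (\big[maxe/-oo%E]_(i | A i) (F i)%:E).

Lemma fmax_attained (R : realType) (I : finType) (A : pred I) (F : I -> R)
    (i0 : I) :
  A i0 -> exists2 i, A i & fmax A F = F i.
Proof.
move=> Ai0; case: (@eq_bigmax _ (\bar R) I -oo%E i0 A (fun i => (F i)%:E)) => //.
  by move=> i _; rewrite leNye.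
by move=> i Ai E; exists i => //; rewrite /fmax E.
Qed.

Lemma fmax_ge (R : realType) (I : finType) (A : pred I) (F : I -> R) (i : I) :
  A i -> F i <= fmax A F.
Proof.
move=> Ai.
have [j Aj E] := @eq_bigmax _ (\bar R) I -oo%E i A (fun i => (F i)%:E) Ai
  (fun i _ => leNye _).
have := @le_bigmax_cond _ (\bar R) I -oo%E i A (fun i => (F i)%:E) Ai.
by rewrite /fmax E lee_fin.
Qed.

Definition argmax (X : Type) (R : realType) (A : set X) (g : X -> R) : set X :=
  [set x | A x /\ forall y, A y -> g y <= g x].

Section vectors.
Context {R : realType} {N : nat}.
Implicit Types x y : 'cV[R]_N.

Definition dot x y : R := (x^T *m y) 0 0.

Definition orthant : set 'cV[R]_N := [set x | forall k, 0 <= x k 0].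

(* In both definitions below, only the restriction of f to the orthant
   matters. *)
Definition concave_on_orthant (f : 'cV[R]_N -> R) : Prop :=
  @convex_function R 'cV[R]_N orthant (fun x => - f x).

(* Monotone in the usual sense of utility theory: more of every good is
   strictly better. Every function that strictly increases as soon as one
   coordinate does satisfies this; constant functions do not. *)
Definition increasing_on_orthant (f : 'cV[R]_N -> R) : Prop :=
  forall x y, orthant x -> orthant y ->
    ((forall k, x k 0 <= y k 0) -> f x <= f y) /\
    ((forall k, x k 0 < y k 0) -> f x < f y).

End vectors.

Section coordination.
Context {R : realType} {N T M : nat}.
Variable alpha : 'I_T -> 'cV[R]_N.

Definition budget_feasible (t : 'I_T) : set ('I_M -> 'cV[R]_N) :=
  [set b | (forall i, orthant (b i)) /\ dot (alpha t) (\sum_i b i) <= 1].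

Definition H0 (beta : 'I_T -> 'I_M -> 'cV[R]_N) : Prop :=
  exists (f : 'I_M -> 'cV[R]_N -> R) (mu : 'I_M -> R),
    [/\ forall i, [/\ concave_on_orthant (f i),
                      {within orthant, continuous (f i)} &
                      increasing_on_orthant (f i)],
        forall i, 0 < mu i &
        forall t, argmax (budget_feasible t)
                    (fun b => \sum_i mu i * f i (b i)) (beta t)].

(* The inequality is imposed on distinct time points only. For s = t it would
   read 0 <= Phi, whereas noise_gap below, a maximum over distinct pairs, can
   be negative. *)
Definition afriat_feasible (b : 'I_T -> 'cV[R]_N) : set R :=
  [set Phi | exists u lambda : 'I_T -> R,
    [/\ forall t, 0 < u t, forall t, 0 < lambda t &
        forall s t, s != t ->
          u s - u t - lambda t * dot (alpha t) (b s - b t) - lambda t * Phi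
            <= 0]].

(* Infimum rather than minimum: as u and lambda range over open sets, the
   optimal value need not be attained. *)
Definition Phihat (b : 'I_T -> 'cV[R]_N) : R := inf (afriat_feasible b).

Definition Phistar (D : 'I_T -> 'I_M -> 'cV[R]_N) : R :=
  fmax xpredT (fun i : 'I_M => Phihat (D ^~ i)).

Definition noise_gap (e : 'I_T -> 'cV[R]_N) : R :=
  fmax (fun p : 'I_T * 'I_T => p.1 != p.2)
    (fun p => dot (alpha p.1) (e p.1 - e p.2)).

End coordination.

(* R^N with its Borel sigma-algebra. *)
Notation borel_cV R N := (g_sigma_algebraType (@open 'cV[R]_N)).

Section measurability.
Context {R : realType} {N T M : nat}.

Lemma measurable_coord (k : 'I_N) :
  measurable_fun [set: borel_cV R N] (fun x => (x : 'cV[R]_N) k 0).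
Proof.
apply: (measurability _ (RGenOInfty.measurableE R)) => _ [_ [a ->] <-].
rewrite setTI; apply: sub_sigma_algebra.
have /continuousP cont := @coord_continuous R N 1 k 0.
by apply: cont; rewrite set_itvE; exact: open_gt.
Qed.

Context d (Omega : measurableType d).

Lemma measurable_dot (a : 'cV[R]_N) (f g : Omega -> borel_cV R N) :
  measurable_fun [set: Omega] f -> measurable_fun [set: Omega] g ->
  measurable_fun [set: Omega]
    (fun w => dot a ((f w : 'cV[R]_N) - (g w : 'cV[R]_N))).
Proof.
move=> mf mg.
rewrite (_ : (fun _ => _) = fun w => \sum_k
    a k 0 * ((f w : 'cV[R]_N) k 0 - (g w : 'cV[R]_N) k 0)); last first.
  by apply/funext => w; rewrite /dot mxE; apply: eq_bigr => k _; rewrite !mxE.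
apply: measurable_sum => k; apply: measurable_funM => //.
by apply: measurable_funB;
  [exact: (measurableT_comp (measurable_coord k) mf) |
   exact: (measurableT_comp (measurable_coord k) mg)].
Qed.

Lemma measurable_fmax (I : finType) (A : pred I) (F : I -> Omega -> R) :
  (forall i, measurable_fun [set: Omega] (F i)) ->
  measurable_fun [set: Omega] (fun w => fmax A (F ^~ w)).
Proof.
move=> mF; apply: measurableT_comp => //.
elim: (index_enum I) => [|i s IH].
  rewrite (_ : (fun _ => _) = cst -oo%E) //.
  by apply/funext => w; rewrite big_nil.
rewrite (_ : (fun _ => _) = fun w =>
    let x := (\big[maxe/-oo%E]_(j <- s | A j) (F j w)%:E)%E in
    if A i then maxe (F i w)%:E x else x); last first.
  by apply/funext => w; rewrite big_cons.
case: (A i) => //; apply: measurable_maxe => //.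
exact/measurable_EFinP/mF.
Qed.

Variables (alpha : 'I_T -> 'cV[R]_N) (P : probability Omega R).
Variable eps : 'I_T -> 'I_M -> {RV P >-> borel_cV R N}.

Definition noisy (beta : 'I_T -> 'I_M -> 'cV[R]_N) (w : Omega)
    (t : 'I_T) (i : 'I_M) : 'cV[R]_N :=
  beta t i + (eps t i w : 'cV[R]_N).

Definition Psi_agent (i : 'I_M) (w : Omega) : R :=
  noise_gap alpha (fun t => eps t i w).

Definition Psi (w : Omega) : R := fmax xpredT (fun i => Psi_agent i w).

Lemma measurable_Psi : measurable_fun [set: Omega] Psi.
Proof.
apply: measurable_fmax => i; apply: measurable_fmax => p.
exact: measurable_dot.
Qed.

HB.instance Definition _ :=
  isMeasurableFun.Build _ _ Omega R Psi measurable_Psi.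

End measurability.

Section probability_notions.
Context {d} {Omega : measurableType d} {R : realType} (P : probability Omega R).

Definition mutually_independent d' (S : measurableType d') (I : finType)
    (X : I -> {RV P >-> S}) : Prop :=
  forall (J : {set I}) (A : I -> set S), (forall j, measurable (A j)) ->
    P (\bigcap_(j in [set` J]) (X j @^-1` A j)) =
      (\prod_(j in J) P (X j @^-1` A j))%E.

Definition is_pdf (X : {RV P >-> R}) (f : R -> R) : Prop :=
  [/\ measurable_fun [set: R] f, forall x, 0 <= f x &
      forall A, measurable A ->
        distribution P X A = (\int[lebesgue_measure]_(x in A) (f x)%:E)%E].

(* Type-I error probability of the detector that computes the complementary cdf
   of the noise statistic X at the test statistic S and compares it with the
   level gamma. H0 is a property of the deterministic probes and true
   responses, so that conditioning on H0 amounts to assuming it: this is the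
   conditional probability whenever H0 holds. *)
Definition type_I_error (X : {RV P >-> R}) (gamma : R)
    (S : Omega -> R) : \bar R :=
  P [set w | (ccdf X (S w) <= gamma%:E)%E].

End probability_notions.

(* Main.v *)
(* Under H0 the joint optimum has a Lagrange multiplier, Slater's condition
   holding at zero consumption because the budget is 1. It yields
   Afriat's inequalities for the true responses of every agent; replacing the
   true responses by the noisy ones perturbs the right-hand sides by at most
   lambda_t Psi^i, so Psi^i is feasible and Phihat^i <= Psi^i. Since the
   complementary cdf is nonincreasing, the rest reduces to
   P(ccdf_Psi(Psi) <= gamma) <= gamma, which holds because Psi has no atoms.
   Phistar is measurable because Phihat^i is 1-Lipschitz in the expenditure
   differences alpha_t^T (b_s - b_t). *)
Require Import Defs.
From mathcomp Require Import all_boot all_order all_algebra.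
From mathcomp Require Import all_classical all_reals all_analysis.
From mathcomp Require Import measurable_realfun lra.

Set Implicit Arguments.
Unset Strict Implicit.
Unset Printing Implicit Defensive.

Import Order.TTheory GRing.Theory Num.Theory.
Import numFieldNormedType.Exports.

Local Open Scope classical_set_scope.
Local Open Scope ring_scope.

(** * Lagrange multiplier for concave maximization under one affine constraint *)

(** The multiplier is the supremum of the slopes [(F x - F b) / (c x - r)] over the infeasible [x]
    of [C]. A chord from such an [x] to a strictly feasible [a] crosses [c = r], where [F] is at
    most [F b]; by concavity each of these slopes is at most [(F b - F a) / (r - c a)]. *)
Lemma lagrange_multiplier (R : realType) (V : lmodType R) (C : set V)
    (F c : V -> R) (r : R) (a0 b : V) :
  (forall (p : R) x y, 0 <= p <= 1 -> C x -> C y ->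
     C (p *: x + (1 - p) *: y)) ->
  (forall (p : R) x y, 0 <= p <= 1 -> C x -> C y ->
     p * F x + (1 - p) * F y <= F (p *: x + (1 - p) *: y)) ->
  (forall (p : R) x y,
     c (p *: x + (1 - p) *: y) = p * c x + (1 - p) * c y) ->
  C a0 -> c a0 < r ->
  argmax (C `&` [set x | c x <= r]) F b ->
  (exists2 x, C x & F b < F x) ->
  exists2 nu, 0 < nu & forall x, C x -> F x <= F b + nu * (c x - c b).
Proof.
move=> convC concF affc Ca0 ca0 [[Cb cb] bmax] [x1 Cx1 Fx1].
pose S := [set q | exists x, [/\ C x, r < c x & q = (F x - F b) / (c x - r)]].
have cx1 : r < c x1.
  by rewrite ltNge; apply/negP => cx1; move: Fx1; rewrite ltNge bmax.
have slope x a : C x -> r < c x -> C a -> c a < r ->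
    (F x - F b) / (c x - r) <= (F b - F a) / (r - c a).
  move=> Cx rx Ca ar.
  have D : 0 < c x - c a by lra.
  (* The weight at which the chord from [a] to [x] meets [c = r]. *)
  pose p := (r - c a) / (c x - c a).
  have pD : r - c a = p * (c x - c a) by rewrite /p divfK// gt_eqF.
  have p01 : 0 <= p <= 1.
    by rewrite ler_pdivrMr // mul1r divr_ge0; lra.
  move: (p) pD p01 => {}p pD p01.
  have cp : c (p *: x + (1 - p) *: a) = r by rewrite affc; nra.
  have Fp : p * F x + (1 - p) * F a <= F b.
    by apply: le_trans (concF _ _ _ p01 Cx Ca) _; apply: bmax; split;
      [exact: convC | rewrite /= cp].
  rewrite ler_pdivrMr ?subr_gt0// mulrAC ler_pdivlMr ?subr_gt0//.
  rewrite pD.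
  have -> : c x - r = (1 - p) * (c x - c a) by nra.
  rewrite !mulrA ler_pM2r//; nra.
have S0 : S !=set0 by exists ((F x1 - F b) / (c x1 - r)); exists x1.
have ubS a : C a -> c a < r -> ubound S ((F b - F a) / (r - c a)).
  by move=> Ca ar _ [x [Cx rx ->]]; exact: slope.
have hubS : has_ubound S by exists ((F b - F a0) / (r - c a0)); exact: ubS.
have le_nu x : C x -> r < c x -> F x - F b <= sup S * (c x - r).
  move=> Cx rx; rewrite -ler_pdivrMr ?subr_gt0//.
  by apply: ub_le_sup => //; exists x.
(* The better point [x1] is infeasible, so its slope is positive. *)
have nu0 : 0 < sup S.
  by have := le_nu _ Cx1 cx1; rewrite -subr_gt0 in cx1; nra.
exists (sup S) => // x Cx.
have : F x - F b <= sup S * (c x - r).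
  have [xr|rx|xr] := ltgtP (c x) r; last 2 first.
  - exact: le_nu.
  - by rewrite xr subrr mulr0 subr_le0; apply: bmax; split=> //=; rewrite xr.
  have : sup S <= (F b - F x) / (r - c x) by apply: ge_sup => //; exact: ubS.
  by rewrite ler_pdivlMr ?subr_gt0//; lra.
(* As [c b <= r] and the multiplier is positive, [r] may be replaced by [c b]. *)
by move: cb => /=; nra.
Qed.

(** * Inner products, the orthant, and Afriat's inequalities under coordination *)

Lemma dotDr (R : realType) N (a x y : 'cV[R]_N) :
  dot a (x + y) = dot a x + dot a y.
Proof. by rewrite /dot mulmxDr mxE. Qed.

Lemma dotZr (R : realType) N (p : R) (a x : 'cV[R]_N) :
  dot a (p *: x) = p * dot a x.
Proof. by rewrite /dot -scalemxAr mxE. Qed.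

Lemma dotBr (R : realType) N (a x y : 'cV[R]_N) :
  dot a (x - y) = dot a x - dot a y.
Proof. by rewrite dotDr -scaleN1r dotZr mulN1r. Qed.

Lemma dot0r (R : realType) N (a : 'cV[R]_N) : dot a 0 = 0.
Proof. by rewrite /dot mulmx0 mxE. Qed.

Lemma orthant_convex (R : realType) N (p : R) (x y : 'cV[R]_N) :
  0 <= p <= 1 -> orthant x -> orthant y -> orthant (p *: x + (1 - p) *: y).
Proof.
move=> /andP[p0 p1] ox oy k; rewrite !mxE.
by rewrite addr_ge0 ?mulr_ge0 ?subr_ge0.
Qed.

Lemma concave_on_orthantP (R : realType) N (f : 'cV[R]_N -> R) (p : R)
    (x y : 'cV[R]_N) :
  concave_on_orthant f -> 0 <= p <= 1 -> orthant x -> orthant y ->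
  p * f x + (1 - p) * f y <= f (p *: x + (1 - p) *: y).
Proof.
move=> cf /andP[p0 p1] ox oy.
have : - f (p *: x + (1 - p) *: y) <= p * - f x + (1 - p) * - f y :=
  cf (Itv01 p0 p1) x y (mem_set ox) (mem_set oy).
by lra.
Qed.

(* The supporting inequality comes from the joint problem: with all other
   responses frozen, Slater's condition fails for an agent whose expenditure
   is 0. *)
Lemma H0_afriat (R : realType) (N T M : nat) (alpha : 'I_T -> 'cV[R]_N)
    (beta : 'I_T -> 'I_M -> 'cV[R]_N) (i : 'I_M) :
  H0 alpha beta ->
  exists u lambda : 'I_T -> R,
    [/\ forall t, 0 < u t, forall t, 0 < lambda t &
        forall s t, u s - u t <= lambda t * dot (alpha t) (beta s i - beta t i)].
Proof.
move=> [f [mu [hf mu0 hmax]]].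
have obeta t j : orthant (beta t j) by case: (hmax t) => -[+ _] _; apply.
have supp t : exists2 nu, 0 < nu & forall x, orthant x ->
    mu i * (f i x - f i (beta t i)) <= nu * dot (alpha t) (x - beta t i).
  pose C := [set b : 'I_M -> 'cV[R]_N | forall j, orthant (b j)].
  pose F (b : 'I_M -> 'cV[R]_N) := \sum_j mu j * f j (b j).
  pose c (b : 'I_M -> 'cV[R]_N) := dot (alpha t) (\sum_j b j).
  have [| | | | | | |nu nu0 sup] :=
      @lagrange_multiplier R ('I_M -> 'cV[R]_N) C F c 1 0 (beta t).
  - by move=> p x y p01 Cx Cy j; exact: orthant_convex.
  - move=> p x y p01 Cx Cy; rewrite /F !mulr_sumr -big_split.
    apply: ler_sum => j _ /=; have [cj _ _] := hf j.
    apply: (@le_trans _ _ (mu j * (p * f j (x j) + (1 - p) * f j (y j)))).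
      by lra.
    by rewrite ler_pM2l//; exact: concave_on_orthantP.
  - by move=> p x y; rewrite /c big_split -!scaler_sumr dotDr !dotZr.
  - by move=> j k; rewrite mxE.
  - by rewrite /c big1// dot0r.
  - exact: hmax.
  (* Raising every coordinate of every response strictly improves the objective; the index [i] makes
     the sum nonempty, hence the comparison strict. *)
  - exists (fun j => beta t j + const_mx 1) => [j k|].
      by rewrite !mxE addr_ge0// obeta.
    apply: ltr_sum => [|j _]; first by apply/hasP; exists i; rewrite ?mem_index_enum.
    rewrite ltr_pM2l//; have [_ _ inc] := hf j.
    have [||_ ] := inc (beta t j) (beta t j + const_mx 1) => //.
      by move=> k; rewrite !mxE addr_ge0// obeta.
    by apply=> k; rewrite !mxE ltrDl.
  (* Only the response of agent [i] changes, so the other agents' terms cancel. *)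
  exists nu => // x ox; pose y j := if j == i then x else beta t j.
  have Cy : C y by move=> j; rewrite /y; case: eqP.
  have yi j : j != i -> y j = beta t j by rewrite /y => /negbTE ->.
  have := sup y Cy; rewrite /F /c.
  have F1 b : \sum_j mu j * f j (b j) =
      mu i * f i (b i) + \sum_(j | j != i) mu j * f j (b j).
    by rewrite (bigD1 i).
  have c1 (b : 'I_M -> 'cV[R]_N) : \sum_j b j = b i + \sum_(j | j != i) b j.
    by rewrite (bigD1 i).
  have Fy : \sum_(j | j != i) mu j * f j (y j) =
      \sum_(j | j != i) mu j * f j (beta t j).
    by apply: eq_bigr => j /yi ->.
  rewrite !F1 !c1 Fy (eq_bigr _ yi) dotBr !dotDr /y eqxx.
  by lra.
have /choice[nu hnu] : forall t, exists nu, 0 < nu /\ forall x, orthant x ->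
    mu i * (f i x - f i (beta t i)) <= nu * dot (alpha t) (x - beta t i).
  by move=> t; have [nu ? ?] := supp t; exists nu.
(* The constant shift makes the utilities positive and drops out of their differences. *)
exists (fun t => f i (beta t i) + (1 + \sum_s `|f i (beta s i)|)).
exists (fun t => nu t / mu i); split=> [t|t|s t].
- rewrite (bigD1 t)//=.
  have : 0 <= \sum_(s | s != t) `|f i (beta s i)| by exact: sumr_ge0.
  by have := ler_norm (- f i (beta t i)); rewrite normrN; lra.
- by rewrite divr_gt0//; case: (hnu t).
- have [_ /(_ _ (obeta s i))] := hnu t.
  rewrite [nu t / _]mulrC -mulrA -ler_pdivlMl//.
  by rewrite opprD addrACA subrr addr0.
Qed.

(** * Feasible relaxation levels and their dependence on the expenditure differences *)

Section afriat_levels.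
Context {R : realType} {T : nat}.
Implicit Types (a : 'I_T * 'I_T -> R) (x e : R).

(* [afriat_feasible] sees the data only through the expenditure differences
   [a (s, t)] = alpha_t^T (b_s - b_t). *)
Definition afriat_levels a : set R :=
  [set x | exists u lambda : 'I_T -> R,
    [/\ forall t, 0 < u t, forall t, 0 < lambda t &
        forall s t, s != t ->
          u s - u t - lambda t * a (s, t) - lambda t * x <= 0]].

Lemma afriat_feasibleE N (alpha b : 'I_T -> 'cV[R]_N) :
  afriat_feasible alpha b =
  afriat_levels (fun p => dot (alpha p.2) (b p.1 - b p.2)).
Proof. by []. Qed.

(** The same [u] and [lambda] serve: raising the level by [e] makes up for a drop of at most [e] in
    the differences. *)
Lemma afriat_levels_shift a a' e x :
  (forall p, a p <= a' p + e) -> afriat_levels a x -> afriat_levels a' (x + e).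
Proof.
move=> aa' [u [l [u0 l0 ul]]]; exists u, l; split=> // s t st.
by have := ul s t st; have := l0 t; have := aa' (s, t); nra.
Qed.

Lemma afriat_levels_nonempty a : afriat_levels a !=set0.
Proof.
exists (\sum_p `|a p|), (fun=> 1), (fun=> 1); split=> // s t _.
rewrite (bigD1 (s, t))//=.
have : 0 <= \sum_(p | p != (s, t)) `|a p| by exact: sumr_ge0.
by have := ler_norm (- a (s, t)); rewrite normrN; lra.
Qed.

Hypothesis T_gt1 : (1 < T)%N.

(* Adding the constraints of (s, t) and (t, s) cancels the u's. *)
Lemma afriat_levels_lbound a : has_lbound (afriat_levels a).
Proof.
pose s := Ordinal (ltnW T_gt1); pose t := Ordinal T_gt1.
exists (- (`|a (s, t)| + `|a (t, s)|)) => x [u [l [u0 l0 ul]]].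
have := ul s t isT; have := ul t s isT.
have := ler_norm (a (s, t)); have := ler_norm (a (t, s)).
have := normr_ge0 (a (s, t)); have := normr_ge0 (a (t, s)).
have := l0 s; have := l0 t; move: (l s) (l t) (u s) (u t) => ls lt us ut.
rewrite leNgt; move=> lt0 ls0 n1 n2 a1 a2 c1 c2; apply/negP => xlt.
(* Below the claimed bound both products are negative, while the two constraints add up to a
   nonnegative sum. *)
have : 0 < - (lt * (a (s, t) + x)) by rewrite -mulrN mulr_gt0//; lra.
have : 0 < - (ls * (a (t, s) + x)) by rewrite -mulrN mulr_gt0//; lra.
by lra.
Qed.

Lemma inf_afriat_levels_lip a a' e :
  (forall p, `|a p - a' p| <= e) ->
  inf (afriat_levels a') <= inf (afriat_levels a) + e.
Proof.
move=> aa'; rewrite -lerBlDr; apply: lb_le_inf; first exact: afriat_levels_nonempty.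
move=> x ax; rewrite lerBlDr; apply: ge_inf; first exact: afriat_levels_lbound.
apply: afriat_levels_shift ax => p.
by have := le_trans (ler_norm _) (aa' p); lra.
Qed.

End afriat_levels.

(** * Measurability of Lipschitz functionals, and error probabilities *)

(** The event [g < c] is a countable union of boxes with rational center [v] and rational radius [e]
    such that [g v + e < c]; the Lipschitz bound keeps [g] below [c] on each box. *)
Lemma measurable_lipschitz d (Omega : measurableType d) (R : realType)
    (I : finType) (g : (I -> R) -> R) (F : I -> Omega -> R) :
  (forall a a' (e : R), (forall i, `|a i - a' i| <= e) -> g a' <= g a + e) ->
  (forall i, measurable_fun [set: Omega] (F i)) ->
  measurable_fun [set: Omega] (fun w => g (F ^~ w)).
Proof.
move=> lip mF.
apply: (measurability _ (RGenInftyO.measurableE R)) => _ [_ [c ->] <-].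
rewrite setTI.
pose v (q : {ffun I -> rat}) i : R := ratr (q i).
pose near_q (q : {ffun I -> rat} * rat) : set Omega :=
  if g (v q.1) + ratr q.2 < c
  then \bigcap_(i in [set: I]) [set w | `|F i w - v q.1 i| < ratr q.2] else set0.
rewrite (_ : _ @^-1` _ = \bigcup_q near_q q).
  apply: countable_bigcupT_measurable; first exact: countableP.
  move=> q; rewrite /near_q; case: ifP => // _.
  apply: fin_bigcap_measurable => // i _.
  rewrite (_ : [set _ | _] = F i @^-1` ball (v q.1 i) (ratr q.2)).
    by rewrite -[X in measurable X]setTI; apply: mF => //; exact: measurable_ball.
  by apply/seteqP; split=> w; rewrite /ball /= distrC.
apply/seteqP; split=> w.
  rewrite /= in_itv/= => gc.
  (* Half the gap, because the radius is spent twice: once in passing to the rational center, once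
     in the condition [g v + e < c]. *)
  have [e] : exists q : rat, ratr q \in `]0, (c - g (F ^~ w)) / 2[.
    by apply: rat_in_itvoo; lra.
  rewrite in_itv/= => /andP[e0 ec].
  have /choice[q qP] : forall i, exists q : rat, `|F i w - ratr q| < ratr e.
    move=> i; have [q] : exists q : rat, ratr q \in `]F i w - ratr e, F i w + ratr e[.
      by apply: rat_in_itvoo; lra.
    rewrite in_itv/= => ?; exists q; rewrite ltr_distlC; lra.
  exists ([ffun i => q i], e) => //.
  have close i : `|F i w - v [ffun i => q i] i| < ratr e by rewrite /v ffunE.
  rewrite /near_q ifT /=; first by move=> i _; exact: close.
  have := lip (F ^~ w) (v [ffun i => q i]) (ratr e) (fun i => ltW (close i)).
by lra.
move=> [q _]; rewrite /near_q; case: ifP => //= gq close.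
rewrite in_itv/=; apply: le_lt_trans gq; apply: lip => i.
by rewrite distrC; exact/ltW/close.
Qed.

Lemma measurable_ccdf_le d d' (Omega : measurableType d)
    (Omega' : measurableType d') (R : realType) (P : probability Omega R)
    (X : {RV P >-> R}) (gamma : R) (S : Omega' -> R) :
  measurable_fun [set: Omega'] S ->
  measurable [set w | (ccdf X (S w) <= gamma%:E)%E].
Proof.
move=> mS; rewrite (_ : [set _ | _] = (ccdf X \o S) @^-1` `]-oo, gamma%:E]).
  rewrite -[X in measurable X]setTI.
  by apply: (measurableT_comp (ccdf_measurable X)) => //; exact: emeasurable_itv.
by apply/seteqP; split=> w; rewrite /= in_itv.
Qed.

(** The set [E] where the complementary cdf is at most [gamma] is closed upwards and, if nonempty,
    has a least element [m]. Hence the error is at most the probability of [X >= m], which without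
    atoms equals the complementary cdf at [m]. *)
Lemma ccdf_self_le d (Omega : measurableType d) (R : realType)
    (P : probability Omega R) (X : {RV P >-> R}) (gamma : R) :
  (forall x, distribution P X [set x] = 0%E) -> 0 <= gamma < 1 ->
  (type_I_error X gamma X <= gamma%:E)%E.
Proof.
move=> atomless /andP[g0 g1]; rewrite /type_I_error.
pose E : set R := [set x | (ccdf X x <= gamma%:E)%E].
have -> : [set w | (ccdf X (X w) <= gamma%:E)%E] = X @^-1` E by [].
have [->|/set0P E0] := eqVneq E set0; first by rewrite preimage_set0 measure0 lee_fin.
have mE : measurable E by exact: (@measurable_ccdf_le _ _ _ _ _ _ X gamma id).
have up x y : E x -> x <= y -> E y.
  by move=> Ex xy; apply: le_trans Ex; exact: ccdf_nonincreasing.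
have lbE : has_lbound E.
  (* The complementary cdf tends to 1 at minus infinity, and [gamma < 1]. *)
  have [x0 x0P] : exists x0, (gamma%:E < ccdf X x0)%E.
    apply: contrapT => /forallNP noX.
    suff : (1 <= gamma%:E)%E by rewrite lee_fin leNgt g1.
    by apply: (cvge_le _ (cvg_ccdfNy1 X)); near=> x; rewrite leNgt; exact/negP.
  exists x0 => y Ey; rewrite leNgt; apply/negP => yx.
  by have := up _ _ Ey (ltW yx); rewrite /E /= leNgt x0P.
pose m := inf E.
(* Right continuity carries the bound from points just above [m] to [m] itself. *)
have Em : E m.
  have rc : ccdf X x @[x --> m^'+] --> ccdf X m by exact: ccdf_right_continuous.
  apply: (cvge_le _ rc).
  near=> x.
  have mx : m < x by near: x; exact: nbhs_right_gt.
  have xm : 0 < x - m by rewrite subr_gt0.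
  have [y Ey yx] := inf_adherent xm (conj E0 lbE).
  by apply: (up y) => //; move: yx; rewrite -/m; lra.
apply: (@le_trans _ _ (distribution P X `[m, +oo[%classic)).
  apply: le_measure; rewrite ?inE; [exact: measurable_funPTI..|].
  by move=> x Ex; rewrite /= in_itv/= andbT; exact: ge_inf.
rewrite -(@setU1itv _ _ _ m false)// measureU//; last first.
  by apply/seteqP; split=> // x [/= ->]; rewrite in_itv/= ltxx.
by rewrite [X in (X + _)%E]atomless add0e.
Unshelve. all: by end_near. Qed.

(** A larger statistic has a smaller complementary cdf, so the rejection event of [S] lies in that
    of [S'] up to a null set. *)
Lemma type_I_error_le d (Omega : measurableType d) (R : realType)
    (P : probability Omega R) (X : {RV P >-> R}) (gamma : R) (S S' : Omega -> R) :
  measurable_fun [set: Omega] S -> measurable_fun [set: Omega] S' ->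
  {ae P, forall w, S w <= S' w} ->
  (type_I_error X gamma S <= type_I_error X gamma S')%E.
Proof.
move=> mS mS' [N [mN PN SN]]; rewrite /type_I_error.
rewrite -(measureU0 (measurable_ccdf_le X gamma mS') mN PN).
apply: le_measure; rewrite ?inE; first exact: measurable_ccdf_le.
  by apply: measurableU => //; exact: measurable_ccdf_le.
move=> w Sw; have [ww|/negP ww] := boolP (S w <= S' w); [left|right].
  by apply: le_trans Sw; exact: ccdf_nonincreasing.
exact: SN.
Qed.

(** * The statistic of the noisy responses and its bound by the noise *)

Section noisy_responses.
Context {R : realType} {N T M : nat} {d : measure_display}.
Context {Omega : measurableType d} {P : probability Omega R}.
Variables (alpha : 'I_T -> 'cV[R]_N) (beta : 'I_T -> 'I_M -> 'cV[R]_N).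
Variable eps : 'I_T -> 'I_M -> {RV P >-> borel_cV R N}.
Hypothesis T_gt1 : (1 < T)%N.

Lemma measurable_Phihat (i : 'I_M) :
  measurable_fun [set: Omega] (fun w => Phihat alpha (noisy eps beta w ^~ i)).
Proof.
pose a (p : 'I_T * 'I_T) (w : Omega) :=
  dot (alpha p.2) (noisy eps beta w p.1 i - noisy eps beta w p.2 i).
apply: (@measurable_lipschitz _ _ _ _ (fun a => inf (afriat_levels a)) a).
  exact: inf_afriat_levels_lip.
move=> [s t].
(* Each expenditure difference is a constant plus a measurable noise term. *)
rewrite (_ : a (s, t) = fun w => dot (alpha t) (beta s i - beta t i) +
    dot (alpha t) ((eps s i w : 'cV[R]_N) - (eps t i w : 'cV[R]_N))).
  by apply: measurable_funD => //; exact: measurable_dot.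
by apply/funext => w; rewrite -dotDr addrACA -opprD.
Qed.

Lemma H0_Phihat_le (w : Omega) (i : 'I_M) :
  H0 alpha beta ->
  Phihat alpha (noisy eps beta w ^~ i) <= Psi_agent alpha eps i w.
Proof.
move=> /(H0_afriat i)[u [l [u0 l0 ul]]].
rewrite /Phihat afriat_feasibleE.
apply: ge_inf; first exact: afriat_levels_lbound.
(* The Afriat numbers of the true responses are kept; the noise is absorbed by the level. *)
exists u, l; split=> // s t st.
(* The constraint at [(s, t)] contains the noise difference with the opposite sign, so the relevant
   pair in the maximum is [(t, s)]. *)
have gap : dot (alpha t) ((eps t i w : 'cV[R]_N) - (eps s i w : 'cV[R]_N))
    <= Psi_agent alpha eps i w.
  by apply: (@fmax_ge _ _ _ _ (t, s)); rewrite eq_sym.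
have -> : dot (alpha t) (noisy eps beta w s i - noisy eps beta w t i) =
    dot (alpha t) (beta s i - beta t i) -
    dot (alpha t) ((eps t i w : 'cV[R]_N) - (eps s i w : 'cV[R]_N)).
  by rewrite -dotBr opprB addrACA -opprD.
by have := ul s t; have := l0 t; nra.
Qed.

Lemma H0_Phistar_le (w : Omega) :
  (0 < M)%N -> H0 alpha beta ->
  Phistar alpha (noisy eps beta w) <= Psi alpha eps w.
Proof.
move=> M0 h0; rewrite /Phistar /Psi.
have [//|i _ ->] := @fmax_attained R 'I_M xpredT
  (fun i => Phihat alpha (noisy eps beta w ^~ i)) (Ordinal M0).
by apply: le_trans (H0_Phihat_le w i h0) _; exact: (@fmax_ge R 'I_M xpredT).
Qed.

End noisy_responses.

Theorem theorem2 (R : realType) (N T M : nat)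
  (hT : (1 < T)%N) (hM : (0 < M)%N)
  (d : measure_display) (Omega : measurableType d) (P : probability Omega R)
  (alpha : 'I_T -> 'cV[R]_N) (beta : 'I_T -> 'I_M -> 'cV[R]_N)
  (halpha : forall t, orthant (alpha t))
  (hbeta : forall t i, orthant (beta t i))
  (Lambda : 'I_T -> 'I_M -> probability (borel_cV R N) R)
  (eps : 'I_T -> 'I_M -> {RV P >-> borel_cV R N})
  (heps_law : forall t i (A : set (borel_cV R N)), measurable A ->
     distribution P (eps t i) A = Lambda t i A)
  (heps_indep : mutually_independent
     (fun ti : 'I_T * 'I_M => eps ti.1 ti.2))
  (f_Psi : R -> R) (hf_Psi : is_pdf (Psi alpha eps : {RV P >-> R}) f_Psi)
  (gamma : R) (hgamma0 : 0 < gamma) (hgamma1 : gamma < 1)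
  (hfeas : forall w i, afriat_feasible alpha (noisy eps beta w ^~ i) !=set0) :
  [/\ [set _ : Omega | H0 alpha beta] `<=`
        \bigcap_(i in [set: 'I_M])
          [set w | Phihat alpha (noisy eps beta w ^~ i)
                     <= Psi_agent alpha eps i w],
      H0 alpha beta ->
        (type_I_error (Psi alpha eps : {RV P >-> R}) gamma
           (fun w => Phistar alpha (noisy eps beta w)) <= gamma%:E)%E &
      H0 alpha beta ->
        forall Phibar : {RV P >-> R},
          {ae P, forall w,
             Phistar alpha (noisy eps beta w) <= Phibar w <= Psi alpha eps w} ->
          (type_I_error (Psi alpha eps : {RV P >-> R}) gamma Phibar >=
           type_I_error (Psi alpha eps : {RV P >-> R}) gamma
             (fun w => Phistar alpha (noisy eps beta w)))%E].
Proof.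
have mPhistar : measurable_fun [set: Omega]
    (fun w => Phistar alpha (noisy eps beta w)).
  by apply: measurable_fmax => i; exact: measurable_Phihat.
split=> [w h0 i _|h0|h0 Phibar]; first exact: H0_Phihat_le.
  (* The noise statistic itself, which dominates [Phistar] under [H0], serves as intermediate test
     statistic. *)
  apply: (@le_trans _ _ (type_I_error (Psi alpha eps : {RV P >-> R}) gamma
                           (Psi alpha eps))).
    by apply: type_I_error_le => //; apply: aeW => w; exact: H0_Phistar_le.
  apply: ccdf_self_le; last by rewrite ltW.
  (* Having a density, the law of the noise statistic gives singletons mass 0. *)
  by move=> x; have [_ _ ->] := hf_Psi; rewrite ?integral_set1.
move=> Phibar_itv; apply: type_I_error_le => //.
by apply: filterS Phibar_itv => w /andP[].
Qed.
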